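(* Let $\mathsf{E}$ be a variety and let $\mathsf{E}^{\leftrightarrow}$ be the subcategory consisting of all objects of $\mathsf{E}$ and all isomorphisms between them. For every algebra $G$ in $\mathsf{E}$, the following equalities of sets hold up to equivalence (of monomorphisms in (1) and (3), of epimorphisms in (2) and (4)): (1) $\{\iota:H\hookrightarrow G\mid \iota\text{ is }\mathsf{E}^{\leftrightarrow}\text{-invariant}\}=\{\mathrm{im}(\eta_G)\mid \eta\in\mathrm{Counital}(\mathsf{E}^{\leftrightarrow},\mathsf{E})\}$; (2) $\{\pi:G\twoheadrightarrow Q\mid \pi\text{ is }\mathsf{E}^{\leftrightarrow}\text{-invariant}\}=\{\mathrm{coim}(\tau_G)\mid \tau\in\mathrm{Unital}(\mathsf{E}^{\leftrightarrow},\mathsf{E})\}$; (3) $\{\iota:H\hookrightarrow G\mid \iota\text{ is }\mathsf{E}\text{-invariant}\}=\{\mathrm{im}(\eta_G)\mid \eta\in\mathrm{Counital}(\mathsf{E},\mathsf{E})\}$; (4) $\{\pi:G\twoheadrightarrow Q\mid \pi\text{ is }\mathsf{E}\text{-invariant}\}=\{\mathrm{coim}(\tau_G)\mid \tau\in\mathrm{Unital}(\mathsf{E},\mathsf{E})\}$. Here $\hookrightarrow$ denotes monomorphisms of $\mathsf{E}$ and $\twoheadrightarrow$ denotes epimorphisms of $\mathsf{E}$.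
   Context: A variety $\mathsf{E}$ is the category of all algebras of a fixed (finitary, single-sorted) signature satisfying a fixed collection of equational laws, with all homomorphisms. For a homomorphism $\varphi:E_1\to E_2$ in $\mathsf{E}$, Noether's Isomorphism Theorem provides a monomorphism $\mathrm{im}(\varphi):\mathrm{Im}(\varphi)\hookrightarrow E_2$ (the image, i.e. the inclusion of the set-theoretic image), an epimorphism $\mathrm{coim}(\varphi):E_1\twoheadrightarrow\mathrm{Coim}(\varphi)$ (the coimage, i.e. the quotient of $E_1$ by the kernel congruence of $\varphi$), and an isomorphism $\psi:\mathrm{Coim}(\varphi)\to\mathrm{Im}(\varphi)$ with $\varphi=\mathrm{im}(\varphi)\,\psi\,\mathrm{coim}(\varphi)$. Two monomorphisms $a,b$ are equivalent if $a=bc$ and $b=ac'$ for some morphisms $c,c'$ of $\mathsf{E}$; two epimorphisms $a,b$ are equivalent if $a=db$ and $b=d'a$ for some morphisms $d,d'$ of $\mathsf{E}$. For a subcategory $\mathsf{B}\le\mathsf{E}$ with inclusion $\mathcal{I}:\mathsf{B}\to\mathsf{E}$: $\mathrm{Counital}(\mathsf{B},\mathsf{E})$ is the collection of all counitals, that is, all natural transformations $\mathcal{K}\mathcal{C}\Rightarrow\mathcal{I}$, where $\mathsf{C}\le\mathsf{E}$ is a subcategory with inclusion functor $\mathcal{K}:\mathsf{C}\to\mathsf{E}$ and $\mathcal{C}:\mathsf{B}\to\mathsf{C}$ is a functor. Dually, $\mathrm{Unital}(\mathsf{B},\mathsf{E})$ is the collection of all unitals, that is, all natural transformations $\mathcal{I}\Rightarrow\mathcal{K}\mathcal{C}$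 with $\mathcal{K}$ and $\mathcal{C}$ of the same kind. The component of such a natural transformation $\eta$ at $G$ is written $\eta_G$. Let $\mathsf{A}$ be a subcategory of $\mathsf{E}$ with the same objects as $\mathsf{E}$. For an object $G$, $\mathsf{A}(G)$ is the full subcategory of $\mathsf{A}$ with the single object $G$. With inclusions $\mathcal{I}:\mathsf{A}(G)\to\mathsf{E}$ and $\mathcal{J}:\mathsf{A}(H)\to\mathsf{E}$, a monomorphism $\iota:H\hookrightarrow G$ is $\mathsf{A}$-invariant if there are a functor $\mathcal{C}:\mathsf{A}(G)\to\mathsf{A}(H)$ and a natural transformation $\eta:\mathcal{J}\mathcal{C}\Rightarrow\mathcal{I}$ whose component $\eta_G$ is a monomorphism equivalent to $\iota$. Dually, an epimorphism $\pi:G\twoheadrightarrow Q$ is $\mathsf{A}$-invariant if there are a functor $\mathcal{C}:\mathsf{A}(G)\to\mathsf{A}(Q)$ and a natural transformation $\tau:\mathcal{I}\Rightarrow\mathcal{J}\mathcal{C}$ (where now $\mathcal{J}:\mathsf{A}(Q)\to\mathsf{E}$ is the inclusion) whose component $\tau_G$ is an epimorphism equivalent to $\pi$.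
   Formalization: Epimorphisms (in ↠, and in the definition of invariant epimorphism) are taken to be surjective homomorphisms; with right-cancellable ones (2) and (4) fail, e.g. for the inclusion of Z into Q in commutative unital rings. *)

(* Defs.v *)
From mathcomp Require Import all_boot.
From mathcomp Require Import boolp classical_sets.

Set Implicit Arguments.
Unset Strict Implicit.
Unset Printing Implicit Defensive.

Declare Scope cat_scope.
Delimit Scope cat_scope with cat.
Local Open Scope cat_scope.

Local Obligation Tactic := idtac.

Record category := Category {
  obj :> Type;
  hom : obj -> obj -> Type;
  idm : forall X, hom X X;
  comp : forall X Y Z, hom Y Z -> hom X Y -> hom X Z;
  comp1m : forall X Y (f : hom X Y), comp (idm Y) f = f;
  compm1 : forall X Y (f : hom X Y), comp f (idm X) = f;
  compA : forall W X Y Z (h : hom Y Z) (g : hom X Y) (f : hom W X),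
    comp h (comp g f) = comp (comp h g) f }.

Arguments hom {c} X Y.
Arguments idm {c} X.

Notation "X ~> Y" := (hom X Y) (at level 99, Y at level 200) : cat_scope.
Notation "g \oc f" := (comp g f) (at level 40, left associativity) : cat_scope.

Record functor (C D : category) := Functor {
  fobj :> C -> D;
  fmap : forall X Y : C, (X ~> Y) -> (fobj X ~> fobj Y);
  fmap1 : forall X, fmap (idm X) = idm (fobj X);
  fmap_comp : forall X Y Z (g : Y ~> Z) (f : X ~> Y),
    fmap (g \oc f) = fmap g \oc fmap f }.

Arguments fmap {C D} _ [X Y] _.

Program Definition functor_comp (B C D : category)
    (G : functor C D) (F : functor B C) : functor B D :=
  @Functor B D (fun X => G (F X)) (fun X Y f => fmap G (fmap F f)) _ _.
Next Obligation. by move=> B C D G F X /=; rewrite !fmap1. Qed.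
Next Obligation. by move=> B C D G F X Y Z g f /=; rewrite !fmap_comp. Qed.

Notation "G \oF F" := (functor_comp G F)
  (at level 40, left associativity) : cat_scope.

Record nat_trans (C D : category) (F G : functor C D) := NatTrans {
  component :> forall X, F X ~> G X;
  naturality : forall X Y (f : X ~> Y),
    component Y \oc fmap F f = fmap G f \oc component X }.

Record subcategory (E : category) := Subcategory {
  in_obj : E -> Prop;
  in_hom : forall X Y : E, (X ~> Y) -> Prop;
  in_hom_obj : forall X Y (f : X ~> Y), in_hom f -> in_obj X /\ in_obj Y;
  in_hom1 : forall X, in_obj X -> in_hom (idm X);
  in_hom_comp : forall X Y Z (g : Y ~> Z) (f : X ~> Y),
    in_hom g -> in_hom f -> in_hom (g \oc f) }.

Section Subcategories.
Variable E : category.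
Implicit Types A B : subcategory E.

Program Definition sub_category B : category :=
  @Category {X : E | in_obj B X}
    (fun X Y => {f : sval X ~> sval Y | in_hom B f})
    (fun X => exist _ (idm (sval X)) (in_hom1 (svalP X)))
    (fun X Y Z g f =>
       exist _ (sval g \oc sval f) (in_hom_comp (svalP g) (svalP f)))
    _ _ _.
Next Obligation. by move=> B X Y [f fB] /=; apply: eq_exist; exact: comp1m. Qed.
Next Obligation. by move=> B X Y [f fB] /=; apply: eq_exist; exact: compm1. Qed.
Next Obligation.
by move=> B W X Y Z [h hB] [g gB] [f fB]; apply: eq_exist; exact: compA.
Qed.

Definition inclusion B : functor (sub_category B) E :=
  @Functor (sub_category B) E (fun X => sval X) (fun X Y f => sval f)
    (fun X => erefl) (fun X Y Z g f => erefl).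

Definition wide A : Prop := forall X, in_obj A X.

Definition wide_obj A (wA : wide A) (G : E) : sub_category A :=
  exist _ G (wA G).

Program Definition whole : subcategory E :=
  @Subcategory E (fun _ => True) (fun _ _ _ => True) _ _ _.
Solve All Obligations with by [].

Lemma whole_wide : wide whole. Proof. by []. Qed.

Definition isomorphism (X Y : E) (f : X ~> Y) : Prop :=
  exists g : Y ~> X, g \oc f = idm X /\ f \oc g = idm Y.

Program Definition isos : subcategory E :=
  @Subcategory E (fun _ => True) (fun X Y f => isomorphism f) _ _ _.
Next Obligation. by []. Qed.
Next Obligation. by move=> X _; exists (idm X); rewrite comp1m. Qed.
Next Obligation.
move=> X Y Z g f [g' [g'g gg']] [f' [f'f ff']]; exists (f' \oc g').
by rewrite -!compA (compA g') g'g comp1m (compA f) ff' comp1m.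
Qed.

Lemma isos_wide : wide isos. Proof. by []. Qed.

Program Definition single A (G : E) : subcategory E :=
  @Subcategory E (fun X => X = G /\ in_obj A X)
    (fun X Y f => [/\ X = G, Y = G & in_hom A f]) _ _ _.
Next Obligation.
by move=> A G X Y f [XG YG /in_hom_obj[AX AY]]; split; split.
Qed.
Next Obligation. by move=> A G X [XG AX]; split=> //; exact: in_hom1. Qed.
Next Obligation.
by move=> A G X Y Z g f [_ ZG gA] [XG _ fA]; split=> //; exact: in_hom_comp.
Qed.

Definition single_obj A (wA : wide A) (G : E) : sub_category (single A G) :=
  exist _ G (conj erefl (wA G)).

Definition monomorphism (H G : E) (i : H ~> G) : Prop :=
  forall (X : E) (u v : X ~> H), i \oc u = i \oc v -> u = v.

Definition equiv_mono (G H K : E) (a : H ~> G) (b : K ~> G) : Prop :=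
  (exists c : H ~> K, a = b \oc c) /\ (exists c' : K ~> H, b = a \oc c').

Definition equiv_epi (G P Q : E) (a : G ~> P) (b : G ~> Q) : Prop :=
  (exists d : Q ~> P, a = d \oc b) /\ (exists d' : P ~> Q, b = d' \oc a).

Definition invariant_mono A (wA : wide A) (H G : E) (i : H ~> G) : Prop :=
  exists (C : functor (sub_category (single A G)) (sub_category (single A H)))
         (eta : nat_trans (inclusion (single A H) \oF C)
                          (inclusion (single A G))),
    let eta_G : sval (C (single_obj wA G)) ~> G := eta (single_obj wA G) in
    monomorphism eta_G /\ equiv_mono eta_G i.

Record counital B := Counital {
  counital_cat : subcategory E;
  counital_fun : functor (sub_category B) (sub_category counital_cat);
  counital_nat : nat_trans (inclusion counital_cat \oF counital_fun)
                           (inclusion B) }.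

Record unital B := Unital {
  unital_cat : subcategory E;
  unital_fun : functor (sub_category B) (sub_category unital_cat);
  unital_nat : nat_trans (inclusion B)
                         (inclusion unital_cat \oF unital_fun) }.

Definition counital_at B (wB : wide B) (eta : counital B) (G : E) :
    sval (counital_fun eta (wide_obj wB G)) ~> G :=
  counital_nat eta (wide_obj wB G).

Definition unital_at B (wB : wide B) (tau : unital B) (G : E) :
    G ~> sval (unital_fun tau (wide_obj wB G)) :=
  unital_nat tau (wide_obj wB G).

Record arrow_to (G : E) := ArrowTo { source : E; to_hom : source ~> G }.
Record arrow_from (G : E) := ArrowFrom { target : E; from_hom : G ~> target }.

End Subcategories.

Arguments whole_wide E : clear implicits.
Arguments isos_wide E : clear implicits.

Definition eq_up_to (T : Type) (equiv : T -> T -> Prop) (A B : set T) : Prop :=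
  (forall a, A a -> exists2 b, B b & equiv a b) /\
  (forall b, B b -> exists2 a, A a & equiv a b).

Definition eq_up_to_mono (E : category) (G : E) : set (arrow_to G) ->
    set (arrow_to G) -> Prop :=
  eq_up_to (fun a b : arrow_to G => equiv_mono (to_hom a) (to_hom b)).

Definition eq_up_to_epi (E : category) (G : E) : set (arrow_from G) ->
    set (arrow_from G) -> Prop :=
  eq_up_to (fun a b : arrow_from G => equiv_epi (from_hom a) (from_hom b)).

Record signature := Signature {
  symbol : Type;
  arity : symbol -> nat }.

Inductive term (S : signature) : Type :=
| Var of nat
| App (s : symbol S) of ('I_(arity s) -> term S).

(* Carriers are allowed to be empty. *)
Record algebra (S : signature) := Algebra {
  carrier :> Type;
  op : forall s : symbol S, ('I_(arity s) -> carrier) -> carrier }.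

Arguments op {S} a s _.

Fixpoint eval (S : signature) (X : algebra S) (env : nat -> X) (t : term S) :
    X :=
  match t with
  | Var n => env n
  | App s ts => op X s (fun i => eval env (ts i))
  end.

Definition satisfies (S : signature) (laws : set (term S * term S))
    (X : algebra S) : Prop :=
  forall l r, laws (l, r) -> forall env : nat -> X, eval env l = eval env r.

Record homomorphism (S : signature) (X Y : algebra S) := Homomorphism {
  hfun :> X -> Y;
  hfun_op : forall s (x : 'I_(arity s) -> X),
    hfun (op X s x) = op Y s (fun i => hfun (x i)) }.

Section Variety.
Variables (S : signature) (laws : set (term S * term S)).

Lemma homomorphism_eq (X Y : algebra S) (f g : homomorphism X Y) :
  (forall x, f x = g x) -> f = g.
Proof.
case: f g => [f fop] [g gop] /= /funext fg.
by subst g; congr Homomorphism; exact: Prop_irrelevance.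
Qed.

Program Definition hid (X : algebra S) : homomorphism X X :=
  @Homomorphism S X X (fun x => x) _.
Solve All Obligations with by [].

Program Definition hcomp (X Y Z : algebra S)
    (g : homomorphism Y Z) (f : homomorphism X Y) : homomorphism X Z :=
  @Homomorphism S X Z (fun x => g (f x)) _.
Next Obligation. by move=> X Y Z g f s x /=; rewrite !hfun_op. Qed.

Program Definition variety : category :=
  @Category {X : algebra S | satisfies laws X}
    (fun X Y => homomorphism (sval X) (sval Y))
    (fun X => hid (sval X)) (fun X Y Z g f => hcomp g f) _ _ _.
Solve All Obligations with by move=> *; exact: homomorphism_eq.

Definition elt (X : variety) : Type := carrier (sval X).

Definition appl (X Y : variety) (f : X ~> Y) : elt X -> elt Y := hfun f.

(* Epimorphisms are read as surjective homomorphisms, i.e. quotient maps.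
   With right-cancellable homomorphisms instead, an invariant epimorphism need
   not be equivalent to a coimage: in commutative unital rings take the
   inclusion of the integers into the rationals. *)
Definition epimorphism (X Y : variety) (f : X ~> Y) : Prop :=
  forall y : elt Y, exists x : elt X, appl f x = y.

Definition invariant_epi (A : subcategory variety) (wA : wide A)
    (G Q : variety) (p : G ~> Q) : Prop :=
  exists (C : functor (sub_category (single A G)) (sub_category (single A Q)))
         (tau : nat_trans (inclusion (single A G))
                          (inclusion (single A Q) \oF C)),
    let tau_G : G ~> sval (C (single_obj wA G)) := tau (single_obj wA G) in
    epimorphism tau_G /\ equiv_epi tau_G p.

Lemma eval_hom (X Y : algebra S) (f : homomorphism X Y) (env : nat -> X) t :
  f (eval env t) = eval (fun n => f (env n)) t.
Proof.
elim: t => [//|s ts IH] /=; rewrite hfun_op; congr (op Y s).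
by apply/funext => i; exact: IH.
Qed.

Section ImageCoimage.
Variables (X Y : variety) (phi : X ~> Y).

Definition im_carrier : Type := {y : elt Y | exists x, appl phi x = y}.

Lemma im_op_subproof s (y : 'I_(arity s) -> im_carrier) :
  exists x, appl phi x = op (sval Y) s (fun i => sval (y i)).
Proof.
have [x xP] := choice (fun i => svalP (y i)).
exists (op (sval X) s x); rewrite /appl hfun_op; congr (op (sval Y) s).
exact/funext.
Qed.

Definition im_algebra : algebra S :=
  @Algebra S im_carrier (fun s y => exist _ _ (im_op_subproof y)).

Definition im_incl : homomorphism im_algebra (sval Y) :=
  @Homomorphism S im_algebra (sval Y) (fun y => sval y) (fun s y => erefl).

Lemma im_satisfies : satisfies laws im_algebra.
Proof.
move=> l r lr env.
have inj : injective im_incl by move=> [u p] [v q] /= uv; exact: eq_exist.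
by apply: inj; rewrite !eval_hom; exact: (svalP Y).
Qed.

Definition Im : variety := exist _ im_algebra im_satisfies.
Definition im : Im ~> Y := im_incl.

Definition ker_class (x : elt X) : elt X -> Prop :=
  fun x' => appl phi x' = appl phi x.

Definition coim_carrier : Type :=
  {c : elt X -> Prop | exists x, c = ker_class x}.

Definition coim_class (x : elt X) : coim_carrier :=
  exist _ (ker_class x) (ex_intro _ x erefl).

Definition coim_repr (c : coim_carrier) : elt X := sval (cid (svalP c)).

Lemma coim_reprK : cancel coim_repr coim_class.
Proof.
by move=> c; case: c => c p; apply: eq_exist; rewrite /coim_repr; case: cid.
Qed.

Lemma coim_classP x x' :
  coim_class x = coim_class x' <-> appl phi x = appl phi x'.
Proof.
split=> [[e]|e]; first by have : ker_class x x by []; rewrite e.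
by apply: eq_exist; apply/predeqP => z; rewrite /ker_class e.
Qed.

(* By coim_proj below the choice of representatives does not matter. *)
Definition coim_algebra : algebra S :=
  @Algebra S coim_carrier
    (fun s c => coim_class (op (sval X) s (fun i => coim_repr (c i)))).

Program Definition coim_proj : homomorphism (sval X) coim_algebra :=
  @Homomorphism S (sval X) coim_algebra coim_class _.
Next Obligation.
move=> s x; apply/coim_classP; rewrite /appl !hfun_op; congr (op (sval Y) s).
by apply/funext => i; apply/coim_classP; rewrite coim_reprK.
Qed.

Lemma coim_satisfies : satisfies laws coim_algebra.
Proof.
move=> l r lr env.
have -> : env = fun n => coim_proj (coim_repr (env n)).
  by apply/funext => n; rewrite /= coim_reprK.
by rewrite -!eval_hom; congr (coim_proj _); exact: (svalP X).
Qed.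

Definition Coim : variety := exist _ coim_algebra coim_satisfies.
Definition coim : X ~> Coim := coim_proj.

End ImageCoimage.

End Variety.

(* Main.v *)
Require Import Defs.
From mathcomp Require Import all_boot.
From mathcomp Require Import boolp classical_sets.

Set Implicit Arguments.
Unset Strict Implicit.
Unset Printing Implicit Defensive.

Local Open Scope classical_set_scope.
Local Open Scope cat_scope.
Local Obligation Tactic := idtac.

(** Let A be the category of all morphisms, or of all isomorphisms.  A
    monomorphism i into G is A-invariant iff every f : G ~> G in A restricts
    along i, and an epimorphism p from G is A-invariant iff every such f
    descends along p.  Naturality of a counital (unital) at the A-endomorphisms
    of G gives this for the image (coimage) of its component.

    Conversely, an invariant i : H ~> G yields the counital whose component at X
    is the inclusion of the subalgebra generated by all f (i h) with f : G ~> X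
    in A; at X = G invariance makes this subalgebra the image of i.  An
    invariant p : G ~> Q yields the unital X ~> Q ^ A(X, G) sending x to
    (p (f x))_f; at X = G invariance makes its kernel the kernel of p. *)

(** * Equality in subcategories, equivalence and cancellation *)

Lemma sub_hom_eq (E : category) (B : subcategory E) (X Y : sub_category B)
  (f g : X ~> Y) : sval f = sval g -> f = g.
Proof. by case: f g => [f Bf] [g Bg] /= fg; exact: eq_exist. Qed.

Lemma equiv_mono_refl (E : category) (H G : E) (i : H ~> G) : equiv_mono i i.
Proof. by split; exists (idm H); rewrite compm1. Qed.

Lemma equiv_epi_refl (E : category) (G Q : E) (p : G ~> Q) : equiv_epi p p.
Proof. by split; exists (idm Q); rewrite comp1m. Qed.

(** The categorical notion of epimorphism, weaker than the surjectivity in [epimorphism]. It makes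
    descended maps unique; their existence rests on surjectivity. *)
Definition right_cancellable (E : category) (G Q : E) (p : G ~> Q) : Prop :=
  forall (X : E) (u v : Q ~> X), u \oc p = v \oc p -> u = v.

(** * Functors and counitals from restriction along monomorphisms *)

Section Restriction.
Variables (E : category) (B C : subcategory E).
Variables (F : sub_category B -> sub_category C).
Variable e : forall X, sval (F X) ~> sval X.
Hypothesis e_mono : forall X, monomorphism (e X).
Hypothesis restrict : forall (X Y : sub_category B) (f : X ~> Y),
  exists f' : F X ~> F Y, e Y \oc sval f' = sval f \oc e X.

(** As [e Y] is monic, [f'] is determined by [f]. The choice is therefore functorial, although [F]
    is given on objects only. *)
Definition restriction (X Y : sub_category B) (f : X ~> Y) :
    F X ~> F Y := sval (cid (restrict f)).

Lemma restrictionE (X Y : sub_category B) (f : X ~> Y) :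
  e Y \oc sval (restriction f) = sval f \oc e X.
Proof. exact: svalP (cid (restrict f)). Qed.

Program Definition restriction_functor :
    functor (sub_category B) (sub_category C) :=
  @Functor _ _ F restriction _ _.
Next Obligation.
move=> X; apply: sub_hom_eq; apply: e_mono.
by rewrite restrictionE /= comp1m compm1.
Qed.
Next Obligation.
move=> X Y Z g f; apply: sub_hom_eq; apply: e_mono.
by rewrite restrictionE /= Defs.compA restrictionE -!Defs.compA restrictionE.
Qed.

Program Definition restriction_nat :
    nat_trans (inclusion C \oF restriction_functor) (inclusion B) :=
  @NatTrans _ _ (inclusion C \oF restriction_functor) (inclusion B) e _.
Next Obligation. exact: restrictionE. Qed.

End Restriction.

(** * Functors and unitals from descent along epimorphisms *)

Section Descent.
Variables (E : category) (B C : subcategory E).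
Variables (F : sub_category B -> sub_category C).
Variable e : forall X, sval X ~> sval (F X).
Hypothesis e_epi : forall X, right_cancellable (e X).
Hypothesis descend : forall (X Y : sub_category B) (f : X ~> Y),
  exists f' : F X ~> F Y, e Y \oc sval f = sval f' \oc e X.

Definition descent (X Y : sub_category B) (f : X ~> Y) :
    F X ~> F Y := sval (cid (descend f)).

Lemma descentE (X Y : sub_category B) (f : X ~> Y) :
  e Y \oc sval f = sval (descent f) \oc e X.
Proof. exact: svalP (cid (descend f)). Qed.

Program Definition descent_functor :
    functor (sub_category B) (sub_category C) :=
  @Functor _ _ F descent _ _.
Next Obligation.
move=> X; apply: sub_hom_eq; apply: e_epi.
by rewrite -descentE /= comp1m compm1.
Qed.
Next Obligation.
move=> X Y Z g f; apply: sub_hom_eq; apply: e_epi.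
by rewrite -descentE /= Defs.compA descentE -!Defs.compA descentE.
Qed.

Program Definition descent_nat :
    nat_trans (inclusion B) (inclusion C \oF descent_functor) :=
  @NatTrans _ _ (inclusion B) (inclusion C \oF descent_functor) e _.
Next Obligation. exact: descentE. Qed.

End Descent.

(** * Invariance as a condition on endomorphisms *)

Section Invariance.
Variables (E : category) (A : subcategory E) (wA : wide A).

(** This weak form is what naturality yields, since equivalence of monomorphisms uses arbitrary
    morphisms of E. The form [restricts_in] is what builds a functor into A(H). *)
Definition restricts (H G : E) (i : H ~> G) : Prop :=
  forall f : G ~> G, in_hom A f -> exists f' : H ~> H, i \oc f' = f \oc i.

Definition restricts_in (H G : E) (i : H ~> G) : Prop :=
  forall f : G ~> G, in_hom A f ->
  exists2 f' : H ~> H, in_hom A f' & i \oc f' = f \oc i.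

Definition descends (G Q : E) (p : G ~> Q) : Prop :=
  forall f : G ~> G, in_hom A f -> exists f' : Q ~> Q, p \oc f = f' \oc p.

Definition descends_in (G Q : E) (p : G ~> Q) : Prop :=
  forall f : G ~> G, in_hom A f ->
  exists2 f' : Q ~> Q, in_hom A f' & p \oc f = f' \oc p.

Definition single_endo (G : E) (f : G ~> G) (Af : in_hom A f) :
    single_obj wA G ~> single_obj wA G :=
  exist _ f (And3 erefl erefl Af).

Lemma restricts_in_invariant (H G : E) (i : H ~> G) :
  monomorphism i -> restricts_in i -> invariant_mono wA i.
Proof.
move=> i_mono i_restr.
(* An object of A(G) is some Y with a proof of Y = G, so i has to be transported along that
   proof. *)
pose e (X : sub_category (single A G)) : H ~> sval X :=
  let: exist Y (conj YG _) := X return H ~> sval X in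
  eq_rect G (fun Z => H ~> Z) i Y (esym YG).
have e_mono X : monomorphism (e X).
  by rewrite /e; case: X => X [eX AX] /=; subst X; exact: i_mono.
have e_restr X Y (f : X ~> Y) :
    exists f' : single_obj wA H ~> single_obj wA H,
      e Y \oc sval f' = sval f \oc e X.
  rewrite /e; case: X f => X [eX AX]; case: Y => Y [eY AY] [f [fX fY Af]] /=.
  subst X Y; have [f' Af' if'] := i_restr _ Af.
  by exists (single_endo Af').
pose F (_ : sub_category (single A G)) := single_obj wA H.
exists (restriction_functor (F := F) e_mono e_restr).
exists (restriction_nat (F := F) e_mono e_restr).
(* At [single_obj wA G] the proof is [erefl], so the transport computes and the component is i
   itself. *)
by split=> //=; exact: equiv_mono_refl.
Qed.

(** With eta_G = i c and i = eta_G c', naturality gives i c C(f) c' = eta_G C(f) c' = f eta_G c' = f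
    i. *)
Lemma invariant_mono_restricts (H G : E) (i : H ~> G) :
  invariant_mono wA i -> restricts i.
Proof.
move=> [C [eta [_ [[c ec] [c' ec']]]]] f Af.
have /= nat_f := naturality eta (single_endo Af).
exists (c \oc sval (fmap C (single_endo Af)) \oc c').
by rewrite !Defs.compA -ec nat_f -Defs.compA -ec'.
Qed.

(** The functor and tau are explicit because [invariant_epi] is defined only in a variety, while
    this argument is purely categorical. *)
Lemma equiv_epi_descends (G Q : E) (p : G ~> Q)
    (C : functor (sub_category (single A G)) (sub_category (single A Q)))
    (tau : nat_trans (inclusion (single A G)) (inclusion (single A Q) \oF C)) :
  equiv_epi (tau (single_obj wA G) : G ~> sval (C (single_obj wA G))) p ->
  descends p.
Proof.
move=> [[d ed] [d' ed']] f Af.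
have /= nat_f := naturality tau (single_endo Af).
exists (d' \oc sval (fmap C (single_endo Af)) \oc d).
by rewrite -Defs.compA -ed -Defs.compA -nat_f Defs.compA -ed'.
Qed.

End Invariance.

(** * Homomorphisms, kernel pairs and factorizations in a variety *)

Section VarietyMorphisms.
Variables (S : signature) (laws : set (term S * term S)).
Implicit Types X Y Z : variety laws.

Lemma appl_comp X Y Z (g : Y ~> Z) (f : X ~> Y) x :
  appl (g \oc f) x = appl g (appl f x).
Proof. by []. Qed.

Lemma appl_op X Y (f : X ~> Y) s (x : 'I_(arity s) -> elt X) :
  appl f (op (sval X) s x) = op (sval Y) s (fun k => appl f (x k)).
Proof. exact: hfun_op. Qed.

Lemma hom_eq X Y (f g : X ~> Y) : (forall x, appl f x = appl g x) -> f = g.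
Proof. exact: homomorphism_eq. Qed.

(** Homomorphisms commute with evaluation of terms, so the two sides of a law agree under every f.
    This serves kernel pairs, generated subalgebras and powers alike. *)
Lemma separated_satisfies (X : algebra S) :
  (forall x y : X, (forall Y (f : homomorphism X (sval Y)), f x = f y) ->
    x = y) ->
  satisfies laws X.
Proof.
move=> sep l r lr env; apply: sep => Y f.
by rewrite !eval_hom; exact: (svalP Y).
Qed.

Section KernelPair.
Variables (X Y : variety laws) (f : X ~> Y).

Definition kerpair_carrier : Type :=
  {x : elt X * elt X | appl f x.1 = appl f x.2}.

Lemma kerpair_op_subproof s (x : 'I_(arity s) -> kerpair_carrier) :
  appl f (op (sval X) s (fun k => (sval (x k)).1)) =
  appl f (op (sval X) s (fun k => (sval (x k)).2)).
Proof.
by rewrite !appl_op; congr (op _ s); apply/funext => k; exact: (svalP (x k)).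
Qed.

Definition kerpair_algebra : algebra S :=
  @Algebra S kerpair_carrier
    (fun s x => exist _ (_, _) (kerpair_op_subproof x)).

Definition kerpair_fst : homomorphism kerpair_algebra (sval X) :=
  @Homomorphism S kerpair_algebra (sval X) (fun x => (sval x).1)
    (fun _ _ => erefl).

Definition kerpair_snd : homomorphism kerpair_algebra (sval X) :=
  @Homomorphism S kerpair_algebra (sval X) (fun x => (sval x).2)
    (fun _ _ => erefl).

Lemma kerpair_satisfies : satisfies laws kerpair_algebra.
Proof.
apply: separated_satisfies => [[[x1 x2] px] [[y1 y2] py]] sep.
apply: eq_exist; move: (sep _ kerpair_fst) (sep _ kerpair_snd) => /=.
by move=> -> ->.
Qed.

End KernelPair.

(** The kernel pair of f lies in the variety and its projections agree after f. Cancelling f equates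
    them, and they separate the coordinates of (x, y). *)
Lemma mono_inj X Y (f : X ~> Y) : monomorphism f -> injective (appl f).
Proof.
move=> f_mono x y fxy.
pose K : variety laws := exist _ _ (@kerpair_satisfies X Y f).
have /f_mono e :
    f \oc (kerpair_fst f : K ~> X) = f \oc (kerpair_snd f : K ~> X).
  by apply: hom_eq => k; exact: (svalP k).
pose k : elt K := exist _ (x, y) fxy.
exact: (congr1 (fun g : K ~> X => appl g k) e).
Qed.

Lemma inj_mono X Y (f : X ~> Y) : injective (appl f) -> monomorphism f.
Proof.
move=> f_inj Z u v fuv; apply: hom_eq => z; apply: f_inj.
by rewrite -!appl_comp fuv.
Qed.

Lemma epi_right_cancellable X Y (f : X ~> Y) :
  epimorphism f -> right_cancellable f.
Proof.
move=> f_epi Z u v uvf; apply: hom_eq => y; have [x <-] := f_epi y.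
by rewrite -!appl_comp uvf.
Qed.

(** Chosen preimages under m respect the operations because this can be checked after applying the
    injective m. *)
Lemma factor_through_inj X Y Z (m : Y ~> Z) (f : X ~> Z) :
  injective (appl m) -> (forall x, exists y, appl m y = appl f x) ->
  exists c : X ~> Y, f = m \oc c.
Proof.
move=> m_inj /choice[c cP].
have c_op s (x : 'I_(arity s) -> sval X) :
    c (op (sval X) s x) = op (sval Y) s (fun k => c (x k)).
  apply: m_inj; rewrite cP !appl_op; congr (op _ s).
  by apply/funext => k; rewrite cP.
exists (Homomorphism c_op : X ~> Y); apply: hom_eq => x.
by rewrite appl_comp -cP.
Qed.

(** For a set-theoretic section r of p, the map f r is a homomorphism: r may fail to respect
    operations, but only within the kernel of p, which f collapses. *)
Lemma factor_through_epi X Y Z (p : X ~> Y) (f : X ~> Z) :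
  epimorphism p ->
  (forall x x', appl p x = appl p x' -> appl f x = appl f x') ->
  exists d : Y ~> Z, f = d \oc p.
Proof.
move=> /choice[r rP] ker_p.
have d_op s (y : 'I_(arity s) -> sval Y) :
    appl f (r (op (sval Y) s y)) = op (sval Z) s (fun k => appl f (r (y k))).
  rewrite -appl_op; apply: ker_p; rewrite rP appl_op; congr (op _ s).
  by apply/funext => k; rewrite rP.
pose d : Y ~> Z := @Homomorphism S (sval Y) (sval Z) (appl f \o r) d_op.
exists d.
by apply: hom_eq => x; apply: ker_p; rewrite rP.
Qed.

Lemma im_inj X Y (f : X ~> Y) : injective (appl (im f)).
Proof. by move=> [x px] [y py] /= xy; exact: eq_exist. Qed.

Lemma imP X Y (f : X ~> Y) (z : elt (Im f)) :
  exists x, appl f x = appl (im f) z.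
Proof. exact: (svalP z). Qed.

Lemma im_factor X Y (f : X ~> Y) x : exists z, appl (im f) z = appl f x.
Proof. by exists (exist _ (appl f x) (ex_intro _ x erefl) : elt (Im f)). Qed.

Lemma coim_epi X Y (f : X ~> Y) : epimorphism (coim f).
Proof. by move=> y; exists (coim_repr y); exact: coim_reprK. Qed.

Lemma coim_ker X Y (f : X ~> Y) x x' :
  appl (coim f) x = appl (coim f) x' <-> appl f x = appl f x'.
Proof. exact: coim_classP. Qed.

(** * Generated subalgebras *)

Section GeneratedSubalgebra.
Variables (X : variety laws) (P : elt X -> Prop).

Inductive generated : elt X -> Prop :=
| generated_base x : P x -> generated x
| generated_op s (x : 'I_(arity s) -> elt X) :
    (forall k, generated (x k)) -> generated (op (sval X) s x).

Definition generated_algebra : algebra S :=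
  @Algebra S {x | generated x}
    (fun s x => exist _ _ (generated_op (fun k => svalP (x k)))).

Definition generated_hom : homomorphism generated_algebra (sval X) :=
  @Homomorphism S generated_algebra (sval X) (fun x => sval x)
    (fun _ _ => erefl).

Lemma generated_satisfies : satisfies laws generated_algebra.
Proof.
apply: separated_satisfies => [[x px] [y py]] sep; apply: eq_exist.
exact: (sep _ generated_hom).
Qed.

Definition generated_sub : variety laws := exist _ _ generated_satisfies.
Definition generated_incl : generated_sub ~> X := generated_hom.

Lemma generated_incl_inj : injective (appl generated_incl).
Proof. by move=> [x px] [y py] /= xy; exact: eq_exist. Qed.

End GeneratedSubalgebra.

Lemma generated_map X Y (P : elt X -> Prop) (R : elt Y -> Prop) (f : X ~> Y) :
  (forall x, P x -> R (appl f x)) ->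
  forall x, generated P x -> generated R (appl f x).
Proof.
move=> PR x; elim=> [{}x /PR|s {}x _ IH]; first exact: generated_base.
by rewrite appl_op; exact: generated_op.
Qed.

Lemma generated_min X Y (P : elt X -> Prop) (f : Y ~> X) :
  (forall x, P x -> exists y, appl f y = x) ->
  forall x, generated P x -> exists y, appl f y = x.
Proof.
move=> Pf x; elim=> [{}x /Pf //|s {}x _ /choice[y yP]].
exists (op (sval Y) s y); rewrite appl_op; congr (op _ s).
exact/funext.
Qed.

(** * Powers of an algebra *)

Section Power.
Variables (I : Type) (Q : variety laws).

Definition power_algebra : algebra S :=
  @Algebra S (I -> elt Q) (fun s q a => op (sval Q) s (fun k => q k a)).

Definition power_proj (a : I) : homomorphism power_algebra (sval Q) :=
  @Homomorphism S power_algebra (sval Q) (fun q => q a) (fun _ _ => erefl).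

Lemma power_satisfies : satisfies laws power_algebra.
Proof.
apply: separated_satisfies => x y sep; apply/funext => a.
exact: (sep _ (power_proj a)).
Qed.

Definition power : variety laws := exist _ _ power_satisfies.

End Power.

Definition power_reindex (I J : Type) (Q : variety laws) (u : J -> I) :
    power I Q ~> power J Q :=
  @Homomorphism S (power_algebra I Q) (power_algebra J Q) (fun q a => q (u a))
    (fun _ _ => erefl).

(** * Invariance, counitals and unitals for a wide subcategory *)

Section WideSubcategory.
Variables (A : subcategory (variety laws)) (wA : wide A).

Lemma descends_in_invariant (G Q : variety laws) (p : G ~> Q) :
  epimorphism p -> descends_in A p -> invariant_epi wA p.
Proof.
move=> p_epi p_desc.
pose e (X : sub_category (single A G)) : sval X ~> Q :=
  let: exist Y (conj YG _) := X return sval X ~> Q in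
  eq_rect G (fun Z => Z ~> Q) p Y (esym YG).
have e_epi (X : sub_category (single A G)) : right_cancellable (e X).
  rewrite /e; case: X => X [eX AX] /=; subst X; exact: epi_right_cancellable.
have e_desc (X Y : sub_category (single A G)) (f : X ~> Y) :
    exists f' : single_obj wA Q ~> single_obj wA Q,
      e Y \oc sval f = sval f' \oc e X.
  rewrite /e; case: X f => X [eX AX]; case: Y => Y [eY AY] [f [fX fY Af]] /=.
  subst X Y; have [f' Af' pf'] := p_desc _ Af.
  by exists (single_endo wA Af').
pose F (_ : sub_category (single A G)) := single_obj wA Q.
exists (descent_functor (F := F) e_epi e_desc).
exists (descent_nat (F := F) e_epi e_desc).
by split=> //=; exact: equiv_epi_refl.
Qed.

Lemma invariant_epi_descends (G Q : variety laws) (p : G ~> Q) :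
  invariant_epi wA p -> descends A p.
Proof.
by move=> [C [tau [_ tau_p]]]; exact: equiv_epi_descends tau_p.
Qed.

(** Naturality at f sends eta_G(x) to eta_G(C(f)(x)), so f preserves the image of eta_G. *)
Lemma counital_im_restricts (eta : counital A) (G : variety laws) :
  restricts A (im (counital_at wA eta G)).
Proof.
move=> f Af; set eta_G := counital_at wA eta G.
pose f_A : wide_obj wA G ~> wide_obj wA G := exist _ f Af.
have nat_f x :
    appl eta_G (appl (sval (fmap (counital_fun eta) f_A)) x) =
    appl f (appl eta_G x).
  exact: (congr1 (fun h : _ ~> G => appl h x)
    (naturality (counital_nat eta) f_A)).
have [|f' ef'] := @factor_through_inj _ _ _ (im eta_G) (f \oc im eta_G)
  (@im_inj _ _ _); last by exists f'.
move=> z; have [x ex] := imP z.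
by rewrite appl_comp -ex -nat_f; exact: im_factor.
Qed.

(** By naturality tau_G(f x) depends only on tau_G(x), so f preserves the kernel congruence of
    tau_G. *)
Lemma unital_coim_descends (tau : unital A) (G : variety laws) :
  descends A (coim (unital_at wA tau G)).
Proof.
move=> f Af; set tau_G := unital_at wA tau G.
pose f_A : wide_obj wA G ~> wide_obj wA G := exist _ f Af.
have nat_f x :
    appl tau_G (appl f x) =
    appl (sval (fmap (unital_fun tau) f_A)) (appl tau_G x).
  exact: (congr1 (fun h : G ~> _ => appl h x)
    (naturality (unital_nat tau) f_A)).
apply: factor_through_epi; first exact: coim_epi.
move=> x x' /coim_ker xx'; apply/coim_ker.
by rewrite nat_f xx' -nat_f.
Qed.

(** * The counital of generated subalgebras *)

Section GeneratedCounital.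
Variables (G H : variety laws) (i : H ~> G).

Definition translates (X : variety laws) : elt X -> Prop :=
  fun x => exists (f : G ~> X) h, in_hom A f /\ x = appl f (appl i h).

(** A counital may land in any subcategory; choosing the whole variety leaves no membership in A to
    check for restricted maps. *)
Definition translates_obj (X : sub_category A) :
    sub_category (whole (variety laws)) :=
  wide_obj (whole_wide _) (generated_sub (@translates (sval X))).

Definition translates_incl (X : sub_category A) :
    sval (translates_obj X) ~> sval X :=
  generated_incl (@translates (sval X)).

(** A morphism f of A carries the generator g(i h) to (f g)(i h), again a generator because A is
    closed under composition. *)
Lemma translates_restrict (X Y : sub_category A) (f : X ~> Y) :
  exists f' : translates_obj X ~> translates_obj Y,
    translates_incl Y \oc sval f' = sval f \oc translates_incl X.
Proof.
have [[x gx]|f' ef'] := factor_through_inj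
  (@generated_incl_inj (sval Y) (@translates (sval Y)))
  (f := sval f \oc translates_incl X); last by exists (exist _ f' I).
suff gfx : generated (@translates (sval Y)) (appl (sval f) x).
  by exists (exist _ _ gfx : elt (generated_sub _)).
apply: generated_map gx => _ [g [h [Ag ->]]].
by exists (sval f \oc g), h; split=> //; exact: in_hom_comp (svalP f) Ag.
Qed.

Lemma translates_mono (X : sub_category A) : monomorphism (translates_incl X).
Proof. exact/inj_mono/generated_incl_inj. Qed.

Definition translates_counital : counital A :=
  Counital (restriction_nat translates_mono translates_restrict).

Lemma translates_counital_im :
  injective (appl i) -> restricts A i ->
  equiv_mono i (im (counital_at wA translates_counital G)).
Proof.
move=> i_inj i_restr.
set eta := counital_at _ _ _.
split; apply: factor_through_inj => //; first exact: im_inj.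
(* The translate by the identity of G puts i h among the generators. *)
- move=> h; have gh : generated (@translates G) (appl i h).
    by apply: generated_base; exists (idm G), h; split=> //; exact: in_hom1.
  exact: (im_factor eta (exist _ _ gh : elt (generated_sub (@translates G)))).
(* Conversely f i = i f' puts every generator in the image of i, which is a subalgebra. *)
- move=> z; have [[x gx] <-] := imP z.
  apply: generated_min gx => _ [f [h [/i_restr[f' ef'] ->]]].
  by exists (appl f' h); rewrite -!appl_comp ef'.
Qed.

End GeneratedCounital.

(** * The unital of powers *)

Section PowerUnital.
Variables (G Q : variety laws) (p : G ~> Q).

Definition power_obj (X : sub_category A) :
    sub_category (whole (variety laws)) :=
  wide_obj (whole_wide _) (power {f : sval X ~> G | in_hom A f} Q).

(** Both A(-, G) and the power in its exponent are contravariant, so the composite is covariant in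
    X. *)
Definition power_map (X Y : sub_category A) (g : X ~> Y) :
    power_obj X ~> power_obj Y :=
  exist _ (power_reindex Q (fun f : {f : sval Y ~> G | in_hom A f} =>
    exist _ (sval f \oc sval g) (in_hom_comp (svalP f) (svalP g)))) I.

Program Definition power_functor :
    functor (sub_category A) (sub_category (whole (variety laws))) :=
  @Functor _ _ power_obj power_map _ _.
Next Obligation.
move=> X; apply: sub_hom_eq; apply: hom_eq => q; apply/funext => -[f Af] /=.
by congr (q _); apply: eq_exist; exact: compm1.
Qed.
Next Obligation.
move=> X Y Z g h; apply: sub_hom_eq; apply: hom_eq => q.
apply/funext => -[f Af] /=.
by congr (q _); apply: eq_exist; exact: Defs.compA.
Qed.

Program Definition power_diag (X : variety laws) :
    X ~> power {f : X ~> G | in_hom A f} Q :=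
  @Homomorphism S (sval X) (power_algebra {f : X ~> G | in_hom A f} Q)
    (fun x f => appl p (appl (sval f) x)) _.
Next Obligation.
by move=> X s x; apply/funext => f; rewrite !appl_op.
Qed.

Program Definition power_nat : nat_trans (inclusion A)
    (inclusion (whole (variety laws)) \oF power_functor) :=
  @NatTrans _ _ (inclusion A)
    (inclusion (whole (variety laws)) \oF power_functor)
    (fun X : sub_category A => power_diag (sval X)) _.
(* Both composites send x to the family k |-> p (k (f x)). *)
Next Obligation. by move=> X Y f; apply: hom_eq. Qed.

Definition power_unital : unital A := Unital power_nat.

Lemma power_unital_coim :
  epimorphism p -> descends A p ->
  equiv_epi p (coim (unital_at wA power_unital G)).
Proof.
move=> p_epi p_desc.
split; apply: factor_through_epi => //; first exact: coim_epi.
- move=> x x' /coim_ker.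
  (* The coordinate at the identity of G is p itself. *)
  by move=> /(congr1 (fun q => q (exist _ (idm G) (in_hom1 (wA G))))).
- move=> x x' xx'; apply/coim_ker; apply/funext => -[f Af].
  (* The coordinate at f is p f = f' p, hence depends only on p x. *)
  have [f' ef'] := p_desc _ Af.
  by rewrite /= -!appl_comp ef' !appl_comp xx'.
Qed.

End PowerUnital.

(** * The two equalities for a wide subcategory, and the case of isomorphisms *)

Lemma invariant_monos_eq_counital_images (G : variety laws) :
  (forall (H : variety laws) (i : H ~> G),
    monomorphism i -> restricts A i -> restricts_in A i) ->
  eq_up_to_mono
    [set i : arrow_to G | monomorphism (to_hom i) /\
       invariant_mono wA (to_hom i)]
    [set ArrowTo (im (counital_at wA eta G)) | eta in [set: counital A]].
Proof.
move=> A_restr; split=> [[H i] /= [i_mono /invariant_mono_restricts i_restr]|].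
  eexists; first by exists (translates_counital i).
  by apply: translates_counital_im => //; exact: mono_inj.
move=> _ [eta _ <-]; eexists; last exact: equiv_mono_refl.
have im_mono := inj_mono (@im_inj _ _ (counital_at wA eta G)).
split=> //; apply: restricts_in_invariant => //.
by apply: A_restr => //; exact: counital_im_restricts.
Qed.

Lemma invariant_epis_eq_unital_coimages (G : variety laws) :
  (forall (Q : variety laws) (p : G ~> Q),
    epimorphism p -> descends A p -> descends_in A p) ->
  eq_up_to_epi
    [set p : arrow_from G | epimorphism (from_hom p) /\
       invariant_epi wA (from_hom p)]
    [set ArrowFrom (coim (unital_at wA tau G)) | tau in [set: unital A]].
Proof.
move=> A_desc; split=> [[Q p] /= [p_epi /invariant_epi_descends p_desc]|].
  eexists; first by exists (power_unital p).
  exact: power_unital_coim.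
move=> _ [tau _ <-]; eexists; last exact: equiv_epi_refl.
have := @coim_epi _ _ (unital_at wA tau G) => c_epi.
split=> //; apply: descends_in_invariant => //.
by apply: A_desc => //; exact: unital_coim_descends.
Qed.

End WideSubcategory.

End VarietyMorphisms.

(** Restrictions f' of f and g' of its inverse g satisfy i g' f' = g f i = i, and symmetrically;
    cancelling i makes them mutually inverse. *)
Lemma isos_restricts_in (E : category) (H G : E) (i : H ~> G) :
  monomorphism i -> restricts (isos E) i -> restricts_in (isos E) i.
Proof.
move=> i_mono i_restr f [g [gf fg]].
have [|f' ef'] := i_restr f; first by exists g.
have [|g' eg'] := i_restr g; first by exists f.
exists f' => //; exists g'; split; apply: i_mono.
- by rewrite Defs.compA eg' -Defs.compA ef' Defs.compA gf comp1m compm1.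
- by rewrite Defs.compA ef' -Defs.compA eg' Defs.compA fg comp1m compm1.
Qed.

Lemma isos_descends_in (E : category) (G Q : E) (p : G ~> Q) :
  right_cancellable p -> descends (isos E) p -> descends_in (isos E) p.
Proof.
move=> p_epi p_desc f [g [gf fg]].
have [|f' ef'] := p_desc f; first by exists g.
have [|g' eg'] := p_desc g; first by exists f.
exists f' => //; exists g'; split; apply: p_epi.
- by rewrite -Defs.compA -ef' Defs.compA -eg' -Defs.compA gf comp1m compm1.
- by rewrite -Defs.compA -eg' Defs.compA -ef' -Defs.compA fg comp1m compm1.
Qed.

Unset Implicit Arguments.

Theorem mainTheorem3 (S : signature) (laws : set (term S * term S))
    (G : variety laws) :
  [/\ eq_up_to_mono
        [set i : arrow_to G | monomorphism (to_hom i) /\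
           invariant_mono (isos_wide (variety laws)) (to_hom i)]
        [set ArrowTo (im (counital_at (isos_wide (variety laws)) eta G))
           | eta in [set: counital (isos (variety laws))]],
      eq_up_to_epi
        [set p : arrow_from G | epimorphism (from_hom p) /\
           invariant_epi (isos_wide (variety laws)) (from_hom p)]
        [set ArrowFrom (coim (unital_at (isos_wide (variety laws)) tau G))
           | tau in [set: unital (isos (variety laws))]],
      eq_up_to_mono
        [set i : arrow_to G | monomorphism (to_hom i) /\
           invariant_mono (whole_wide (variety laws)) (to_hom i)]
        [set ArrowTo (im (counital_at (whole_wide (variety laws)) eta G))
           | eta in [set: counital (whole (variety laws))]] &
      eq_up_to_epi
        [set p : arrow_from G | epimorphism (from_hom p) /\
           invariant_epi (whole_wide (variety laws)) (from_hom p)]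
        [set ArrowFrom (coim (unital_at (whole_wide (variety laws)) tau G))
           | tau in [set: unital (whole (variety laws))]]].
Proof.
split.
- by apply: invariant_monos_eq_counital_images => H i; exact: isos_restricts_in.
- apply: invariant_epis_eq_unital_coimages => Q p /epi_right_cancellable.
  exact: isos_descends_in.
(* Every morphism belongs to [whole], so any restriction already lies in A. *)
- apply: invariant_monos_eq_counital_images => H i _ i_restr f Af.
  by have [f' ef'] := i_restr f Af; exists f'.
- apply: invariant_epis_eq_unital_coimages => Q p _ p_desc f Af.
  by have [f' ef'] := p_desc f Af; exists f'.
Qed.
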